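(* Let $n\ge 4$ and let $\mathbb{B}_n$ be the set of strongly connected bicyclic digraphs of order $n$. Then, up to isomorphism, the unique digraph in $\mathbb{B}_n$ achieving the second maximum spectral radius among digraphs in $\mathbb{B}_n$ is $\infty(3,n-2)$ if $5\le n\le 7$, and $\theta(0,n-2,0)$ if $n=4$ or $n\ge 8$.
   Context: Digraphs have no loops and no multiple arcs (arcs $uv$ and $vu$ may both be present). The spectral radius $\rho(D)$ of a digraph $D$ is the largest modulus of an eigenvalue of its adjacency matrix. A digraph is strongly connected if for every ordered pair of vertices there is a directed path from the first to the second; a strongly connected bicyclic digraph is a strongly connected digraph with $|E(D)|=|V(D)|+1$. Let $P_m$ denote a directed path on $m$ vertices. For integers $0\le a\le b$, $c\ge 0$, the $\theta$-digraph $\theta(a,b,c)$ consists of three internally vertex-disjoint directed paths $P_{a+2}$, $P_{b+2}$, $P_{c+2}$ such that $P_{a+2}$ and $P_{b+2}$ both start at the terminal vertex of $P_{c+2}$ and both end at the initial vertex of $P_{c+2}$; it has order $a+b+c+2$. For integers $2\le k\le l$, the $\infty$-digraph $\infty(k,l)$ consists of a directed cycle of length $k$ and a directed cycle of length $l$ having exactly one vertex in common; it has order $k+l-1$. *)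

(* Defs.v *)
From mathcomp Require Import all_boot all_order all_algebra.
From mathcomp Require Import all_classical all_reals.
From mathcomp Require Import complex.

Set Implicit Arguments.
Unset Strict Implicit.
Unset Printing Implicit Defensive.

Import Order.TTheory GRing.Theory Num.Theory.

(* [arc] being a relation on vertices, there are no multiple arcs. *)
Record digraph := Digraph {
  vertex : finType;
  arc : rel vertex;
  arc_irr : irreflexive arc
}.

Definition digraph_order (D : digraph) : nat := #|vertex D|.

Definition digraph_size (D : digraph) : nat :=
  #|[set e : vertex D * vertex D | arc e.1 e.2]%SET|.

Definition strongly_connected (D : digraph) : Prop :=
  forall x y : vertex D, connect (@arc D) x y.

Definition digraph_iso (D D' : digraph) : Prop :=
  exists2 f : vertex D -> vertex D',
    bijective f & forall x y, arc (f x) (f y) = arc x y.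

Definition bicyclic (n : nat) (D : digraph) : Prop :=
  [/\ digraph_order D = n, strongly_connected D & digraph_size D = n.+1].

Definition adjacency (K : nzRingType) (D : digraph) : 'M[K]_(digraph_order D) :=
  \matrix_(i, j) ((arc (enum_val i) (enum_val j))%:R)%R.

(* The spectrum of a nonempty digraph is finite and nonempty, so this supremum
   is a maximum.  [eigenvalue] refers to row eigenvectors; a matrix and its
   transpose have the same eigenvalues. *)
Definition spectral_radius (R : realType) (D : digraph) : R :=
  sup [set ComplexField.Normc.normc z
      | z in [set z : R[i] | eigenvalue (adjacency R[i] D) z]]%classic.

Definition walk_arcs (p : seq nat) : seq (nat * nat) := zip p (behead p).

Definition walks_arc (m : nat) (ps : seq (seq nat)) : rel 'I_m :=
  fun x y => (x != y) &&
    has (fun p => (val x, val y) \in walk_arcs p) ps.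

Lemma walks_arc_irr m ps : irreflexive (@walks_arc m ps).
Proof. by move=> x; rewrite /walks_arc eqxx. Qed.

(* The union of the walks [ps] on the vertices 0, ..., m - 1.  Walks with two
   equal consecutive vertices do not occur below in the intended parameter
   ranges, so discarding loops is harmless. *)
Definition walks_digraph (m : nat) (ps : seq (seq nat)) : digraph :=
  Digraph (@walks_arc_irr m ps).

(* Vertex 0 is the initial and vertex 1 the terminal vertex of P_(c+2).
   Intended for a <= b with 0 < b: for a = b = 0 the two paths from 1 to 0
   would be parallel arcs. *)
Definition theta (a b c : nat) : digraph :=
  walks_digraph (a + b + c + 2)
    [:: 1 :: rcons (iota 2 a) 0;
        1 :: rcons (iota (a + 2) b) 0;
        0 :: rcons (iota (a + b + 2) c) 1].

(* The common vertex is 0.  Intended for 2 <= k <= l. *)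
Definition infty (k l : nat) : digraph :=
  walks_digraph (k + l - 1)
    [:: 0 :: rcons (iota 1 (k - 1)) 0;
        0 :: rcons (iota k (l - 1)) 0].

Definition achieves_max (T : Type) (R : realType) (P : T -> Prop) (f : T -> R)
    (x : T) : Prop :=
  P x /\ forall y, P y -> (f y <= f x)%R.

(* [f x] is the second largest value taken by [f] on [P]. *)
Definition achieves_second_max (T : Type) (R : realType) (P : T -> Prop)
    (f : T -> R) (x : T) : Prop :=
  exists2 m, achieves_max P f m &
    achieves_max (fun y => P y /\ (f y < f m)%R) f x.

(* Main.v *)
(* Strong connectivity and |E| = |V| + 1 force exactly one vertex x of out-degree
   2, all others having out-degree 1.  The two forced walks leaving x return to
   x and merge on the way, so the digraph is given by the numbers a <= b of
   vertices on the two branches before the merge and the number c + 1 of common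
   vertices, n = a + b + c + 1; it is theta(a,b,c-1) if 0 < c and
   infty(a+1,b+1) if c = 0.
   If q in (0,1) solves q^(n-a) + q^(n-b) = 1, then v |-> q^dist(v,x) is a
   positive eigenvector for 1/q, so the spectral radius is 1/q.  Comparing two
   digraphs thus amounts to evaluating one of these sums at the root of the
   other.  By convexity of i |-> q^i the largest sum has (a,b) = (1,n-2);
   the candidates for the second are (0,n-2) and (2,n-3), and these are
   separated by the sign of q^(n-4)(1+q) - 1 at a root q. *)
Require Import Defs.
From mathcomp Require Import all_boot all_order all_algebra.
From mathcomp Require Import all_classical all_reals.
From mathcomp Require Import complex.
From mathcomp Require Import zify ring lra.

Set Implicit Arguments.
Unset Strict Implicit.
Unset Printing Implicit Defensive.

Import Order.TTheory GRing.Theory Num.Theory.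

Local Notation arc := Defs.arc.

(* Vertex 0 is the branching vertex, 0, ..., c the common part, c+1, ..., c+a and
   c+a+1, ..., c+a+b the two branches; every arc but the two leaving 0 and the
   one entering the common part from the second branch is i -> i-1. *)
Definition shape_step (a c i : nat) : nat := if i == (a + c).+1 then c else i.-1.

Definition shape_arc (a b c : nat) : rel nat := fun i j =>
  if i == 0 then (j == a + c) || (j == a + b + c) else j == shape_step a c i.

Definition has_shape (D : digraph) (a b c : nat) : Prop :=
  exists2 h : 'I_(a + b + c).+1 -> vertex D,
    bijective h & forall i j, arc (h i) (h j) = shape_arc a b c i j.

Lemma shape_iso (D D' : digraph) (a b c : nat) :
  has_shape D a b c -> has_shape D' a b c -> digraph_iso D D'.
Proof.
move=> [h [g hK gK] arch] [h' bij_h' arch'].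
exists (h' \o g); first by apply: bij_comp => //; exists h.
by move=> u v /=; rewrite arch' -arch !gK.
Qed.

(** * Self-maps with an absorbing fixed point *)

Section HittingTime.

Variables (T : eqType) (f : T -> T) (x : T).
Hypotheses (fx : f x = x) (hits : forall v, exists i, iter i f v == x).

Definition hitting_time (v : T) : nat := ex_minn (hits v).
Local Notation d := hitting_time.

Lemma iter_hit (v : T) (i : nat) : (iter i f v == x) = (d v <= i).
Proof.
rewrite /hitting_time; case: ex_minnP => m /eqP mx min_m; apply/idP/idP => [/min_m //|le_mi].
by rewrite -(subnK le_mi) iterD mx; elim: (i - m) => //= k /eqP ->; rewrite fx.
Qed.

Lemma hitting_time_iter (v : T) (i : nat) : d (iter i f v) = d v - i.
Proof.
have iter_dE j : (d (iter i f v) <= j) = (d v <= j + i) by rewrite -!iter_hit iterD.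
have := iter_dE (d v - i); have := iter_dE (d (iter i f v)); rewrite leqnn; lia.
Qed.

(** Decidable membership in the forward orbit of [p]. Hitting times drop by one per step until they
    reach 0, so [d p - d v] is the only time that has to be tested. *)
Definition on_orbit (p v : T) : bool := v == iter (d p - d v) f p.

Lemma on_orbit_iter (p : T) (i : nat) : on_orbit p (iter i f p).
Proof.
rewrite /on_orbit hitting_time_iter; have [le_i|lt_i] := leqP i (d p).
  by rewrite subKn.
have -> : d p - i = 0 by lia.
have /eqP -> : iter i f p == x by rewrite iter_hit ltnW.
by rewrite subn0 eq_sym iter_hit.
Qed.

Lemma on_orbitP (p v : T) : reflect (exists i, v = iter i f p) (on_orbit p v).
Proof.
by apply: (iffP idP) => [/eqP v_p|[i ->]]; [eexists; exact: v_p|exact: on_orbit_iter].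
Qed.

Lemma on_orbit_step (p v : T) (i : nat) : on_orbit p v -> on_orbit p (iter i f v).
Proof. by move=> /on_orbitP[j ->]; rewrite -iterD on_orbit_iter. Qed.

Lemma on_orbit_le (p v : T) : on_orbit p v -> d v <= d p.
Proof. by move=> /on_orbitP[j ->]; rewrite hitting_time_iter leq_subr. Qed.

End HittingTime.

(** * Digraphs with one branching vertex *)

Section TwoOrbits.

Variables (D : digraph) (x p y : vertex D) (f : vertex D -> vertex D).
Hypotheses (fx : f x = x) (hits : forall v, exists i, iter i f v == x).
Hypotheses (px : p != x) (py : p != y).
Hypothesis covered :
  forall v, (exists i, v = iter i f p) \/ (exists i, v = iter i f y).
Hypothesis arcE :
  forall u v, arc u v = if u == x then (v == p) || (v == y) else v == f u.

Local Notation d := (hitting_time hits).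
Local Notation on_orbit := (on_orbit hits).

Hypothesis d_le : d p <= d y.

(** The orbit of [y] joins that of [p] after [b] steps, at a point [z] with [d z = c]. A vertex on
    the orbit of [p] is labelled by its hitting time, a vertex that [y] meets before [z] by its
    hitting time plus [a]. *)
Lemma two_orbits_shape :
  exists a b c, [/\ a <= b, 0 < b, 0 < a + c & has_shape D a b c].
Proof.
have meets : exists j, on_orbit p (iter j f y).
  exists (d y); have /eqP -> : iter (d y) f y == x by rewrite (iter_hit fx hits).
  by apply/on_orbitP => //; exists (d p); apply/esym/eqP; rewrite (iter_hit fx hits).
case: (ex_minnP meets) => b b_on b_min; set z := iter b f y in b_on.
have dz : d z = d y - b by rewrite hitting_time_iter.
have b_le : b <= d y.
  apply: b_min; have /eqP -> : iter (d y) f y == x by rewrite (iter_hit fx hits).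
  by apply/on_orbitP => //; exists (d p); apply/esym/eqP; rewrite (iter_hit fx hits).
have c_le : d z <= d p by exact: on_orbit_le b_on.
have dp_gt0 : 0 < d p by rewrite ltnNge -(iter_hit fx hits).
(* If [y] were on the orbit of [p], then [d p <= d y] would force [y = p]. *)
have b_gt0 : 0 < b.
  rewrite lt0n; apply: contra py => /eqP b0; move: b_on; rewrite /z b0 /=.
  have -> : on_orbit p y = (y == iter (d p - d y) f p) by [].
  by have -> : d p - d y = 0 by [lia]; rewrite /= eq_sym.
set c := d z in c_le dz; pose a := d p - c.
have acE : a + c = d p by rewrite subnK.
have bcE : b + c = d y by lia.
exists a, b, c; split; try lia.
pose h k := if k <= d p then iter (d p - k) f p else iter (d y + a - k) f y.
have h_on k : k <= a + b + c -> on_orbit p (h k) = (k <= d p).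
  move=> lek; rewrite /h; case: leqP => [_|lt_k]; first exact: on_orbit_iter.
  by apply/negP => /b_min; lia.
have d_h k : k <= a + b + c -> d (h k) = if k <= d p then k else k - a.
  by move=> lek; rewrite /h; case: leqP => lt_k; rewrite hitting_time_iter //; lia.
(* A vertex determines its label: membership in the orbit of [p] tells the range, the hitting time
   the position in it. *)
have h_inj i j : i <= a + b + c -> j <= a + b + c -> (h i == h j) = (i == j).
  move=> lei lej; apply/eqP/eqP => [hij|-> //].
  have := h_on i lei; have := d_h i lei; rewrite hij h_on // d_h // => dE onE.
  by move: dE; rewrite onE; case: (leqP i (d p)) (onE); lia.
have h_surj v : exists2 k, k < (a + b + c).+1 & h k = v.
  have [v_on|v_off] := boolP (on_orbit p v).
    have le_v := on_orbit_le fx v_on; exists (d v); first by lia.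
    by rewrite /h le_v; exact/esym/eqP.
  have /eqP v_y : on_orbit y v.
    case: (covered v) => [v_p|v_y]; last exact/(on_orbitP fx).
    by case/negP: v_off; exact/(on_orbitP fx).
  have lt_b : d y - d v < b.
    rewrite ltnNge; apply: contra v_off => le_b.
    by rewrite v_y -(subnK le_b) iterD on_orbit_step.
  exists (d v + a).
    have : d v <= d y by apply: (on_orbit_le fx); exact/eqP.
    by lia.
  by rewrite /h ifN ?subnDr //; lia.
have dy_gt : d p < d y + a by lia.
have hp : h (a + c) = p by rewrite /h acE leqnn subnn.
have hy : h (a + b + c) = y by rewrite /h (_ : d y + a = a + b + c) ?subnn ?ifN //; lia.
have hx : h 0 = x by rewrite /h subn0; apply/eqP; rewrite (iter_hit fx hits).
have hz : h c = z by rewrite /h c_le; exact/esym/eqP.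
have h_step i : 0 < i <= a + b + c -> f (h i) = h (shape_step a c i).
  rewrite /shape_step => /andP[i_gt0 lei]; case: eqP => [->|i_neq].
    by rewrite hz /h acE ltnn -iterS /z; congr (iter _ f y); lia.
  rewrite /h; case: (leqP i (d p)) => lt_i; rewrite -iterS.
    by rewrite (leq_trans (leq_pred i) lt_i); congr (iter _ f p); lia.
  by rewrite ifN; [congr (iter _ f y)|]; lia.
exists (fun i : 'I_(a + b + c).+1 => h i); last first.
  move=> i j; have := ltn_ord i; have := ltn_ord j; rewrite !ltnS => lej lei.
  rewrite arcE /shape_arc -{1}hx h_inj //.
  case: eqP => [_|i_neq]; first by rewrite -{1}hp -{1}hy !h_inj //; lia.
  have step_le : shape_step a c i <= a + b + c by rewrite /shape_step; case: ifP; lia.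
  by rewrite h_step ?h_inj //; lia.
have ord_surj v : exists i : 'I_(a + b + c).+1, h i == v.
  by have [k lt_k <-] := h_surj v; exists (Ordinal lt_k).
exists (fun v => xchoose (ord_surj v)); last first.
  by move=> v; apply/eqP; exact: (xchooseP (ord_surj v)).
apply: inj_can_sym; first by move=> v; apply/eqP; exact: (xchooseP (ord_surj v)).
move=> i j /eqP; rewrite h_inj ?leq_ord // => /eqP; exact: val_inj.
Qed.
End TwoOrbits.

(** * Bicyclic digraphs and shapes *)

Lemma digraph_sizeE (D : digraph) :
  digraph_size D = \sum_u #|[set v : vertex D | arc u v]%SET|.
Proof.
rewrite /digraph_size -sum1_card.
under [RHS]eq_bigr do rewrite -sum1_card.
rewrite pair_big_dep /=; apply: eq_bigl => -[u v]; by rewrite !inE.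
Qed.

Lemma has_shape_order (D : digraph) (a b c : nat) :
  has_shape D a b c -> digraph_order D = (a + b + c).+1.
Proof. by move=> [h bij_h _]; rewrite /digraph_order -(bij_eq_card bij_h) card_ord. Qed.

Lemma strongly_connected_out (D : digraph) (u : vertex D) :
  1 < digraph_order D -> strongly_connected D -> exists v, arc u v.
Proof.
move=> /card_gt1P/=[v [w [_ _ neq_vw]]] conn.
have {v w neq_vw} [w neq_uw] : exists w, u != w.
  by have [->|?] := eqVneq u v; [exists w|exists v].
case/connectP: (conn u w) => -[|v s] /= => [_ uw|/andP[uv _] _]; last by exists v.
by rewrite uw eqxx in neq_uw.
Qed.

(** Out-degrees are positive and their excesses over 1 sum to 1, so a single vertex has out-degree
    2. The convention [f x = x] makes [x] absorbing, as hitting times require. *)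
Lemma branching_vertex (D : digraph) :
  1 < digraph_order D -> strongly_connected D ->
  digraph_size D = (digraph_order D).+1 ->
  exists x p y (f : vertex D -> vertex D), [/\ p != x, y != x, p != y, f x = x &
    forall u v, arc u v = if u == x then (v == p) || (v == y) else v == f u].
Proof.
move=> D_gt1 conn size_D; pose N (u : vertex D) := [set v | arc u v]%SET.
have N_gt0 u : 0 < #|N u|.
  have [v uv] := strongly_connected_out u D_gt1 conn.
  by apply/card_gt0P; exists v; rewrite inE.
have : \sum_u (#|N u| - 1) == 1.
  have : \sum_u (#|N u| - 1) + digraph_order D = (digraph_order D).+1.
    rewrite -size_D digraph_sizeE /digraph_order -sum1_card -big_split /=.
    by apply: eq_bigr => u _; rewrite subnK.
  by lia.
case/sum_nat_eq1 => x [_ Nx N_other].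
have /cards2P[p [y [neq_py NxE]]] : #|N x| == 2 by move: (N_gt0 x); lia.
pose f u := if u == x then x else odflt u [pick v | arc u v].
exists x, p, y, f.
have xE v : arc x v = (v == p) || (v == y).
  by have /setP/(_ v) := NxE; rewrite !inE.
split=> //; try by apply/eqP => ux; have := xE x; rewrite arc_irr -ux eqxx ?orbT.
  by rewrite /f eqxx.
move=> u v; case: eqP => [->|/eqP neq_ux]; first exact: xE.
have /cards1P[w Nu] : #|N u| == 1.
  by move: (N_gt0 u) (N_other u neq_ux isT); lia.
have uE z : arc u z = (z == w) by have /setP/(_ z) := Nu; rewrite !inE.
rewrite /f (negPf neq_ux) uE; case: pickP => [z|/(_ w)]; rewrite uE; last by rewrite eqxx.
by move/eqP ->.
Qed.

Lemma bicyclic_shape (n : nat) (D : digraph) : 1 < n -> bicyclic n D ->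
  exists a b c, [/\ a <= b, 0 < b, 0 < a + c, (a + b + c).+1 = n & has_shape D a b c].
Proof.
move=> n_gt1 [order_D conn size_D]; rewrite -order_D in n_gt1 size_D.
have [x [p [y [f [px yx py fx arcE]]]]] := branching_vertex n_gt1 conn size_D.
have hits v : exists i, iter i f v == x.
  have /connectP[s] := conn v x; elim: s v => [|w s IHs] v /=.
    by move=> _ ->; exists 0.
  rewrite arcE; case: eqP => [->|_] /andP[+ w_s]; first by exists 0.
  by move=> /eqP vw x_s; have [i ?] := IHs w w_s x_s; exists i.+1; rewrite iterSr -vw.
have orbit_x w : exists i, x = iter i f w by have [i /eqP] := hits w; exists i.
(* On a path from [x] to [v], each passage through [x] restarts in [p] or [y], and every other arc
   is a step of [f]. *)
have covered v : (exists i, v = iter i f p) \/ (exists i, v = iter i f y).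
  have /connectP[s] := conn x v; elim/last_ind: s v => [|s w IHs] v /=.
    by move=> _ ->; left.
  rewrite rcons_path last_rcons arcE => /andP[x_s] + ->.
  case: eqP => [_ /orP[]/eqP ->|_ /eqP ->]; try by [left; exists 0|right; exists 0].
  by case: (IHs _ x_s erefl) => -[i ->]; [left|right]; exists i.+1.
have shaped a b c : [/\ a <= b, 0 < b, 0 < a + c & has_shape D a b c] ->
    [/\ a <= b, 0 < b, 0 < a + c, (a + b + c).+1 = n & has_shape D a b c].
  by case=> ? ? ? shape_D; split=> //; rewrite -order_D (has_shape_order shape_D).
have [le_py|/ltnW le_yp] := leqP (hitting_time hits p) (hitting_time hits y).
  have [a [b [c]]] := two_orbits_shape fx px py covered arcE le_py.
  by exists a, b, c; exact: shaped.
have [] := @two_orbits_shape D x y p f fx hits _ _ _ _ le_yp => //.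
- by rewrite eq_sym.
- by move=> v; case: (covered v); [right|left].
- by move=> u v; rewrite orbC.
by move=> a [b [c]]; exists a, b, c; exact: shaped.
Qed.

(** Arcs out of nonzero labels decrease the label, so 0 is reached from everywhere. Conversely
    [a + c] and [a + b + c] are entered from 0, and every other label from its successor. As
    [0 < b], the two out-neighbours of 0 differ. *)
Lemma shape_bicyclic (D : digraph) (a b c : nat) :
  0 < b -> has_shape D a b c -> bicyclic (a + b + c).+1 D.
Proof.
move=> b_gt0 shape_D; split; first exact: has_shape_order shape_D.
  case: shape_D => h [g hK gK] arcE u v.
  have arc_inord i j : i <= a + b + c -> j <= a + b + c ->
      shape_arc a b c i j -> connect (@arc D) (h (inord i)) (h (inord j)).
    by move=> lei lej ij; apply: connect1; rewrite arcE !inordK.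
  have to0 i : i <= a + b + c -> connect (@arc D) (h (inord i)) (h (inord 0)).
    elim/ltn_ind: i => i IHi lei; have [->|i_neq0] := eqVneq i 0; first exact: connect0.
    have step_lt : shape_step a c i < i by rewrite /shape_step; case: ifP; lia.
    apply: connect_trans (IHi _ step_lt _); last by lia.
    by apply: arc_inord; rewrite /shape_arc ?(negPf i_neq0) //; lia.
  have from0 i : i <= a + b + c -> connect (@arc D) (h (inord 0)) (h (inord i)).
    move=> lei; have [k def_i] : exists k, i = a + b + c - k by exists (a + b + c - i); lia.
    elim: k i lei def_i => [|k IHk] i lei ->.
      by apply: arc_inord; rewrite /shape_arc ?eqxx ?orbT //; lia.
    have [eq_i|neq_i] := eqVneq (a + b + c - k.+1) (a + c).
      by rewrite eq_i; apply: arc_inord; rewrite /shape_arc ?eqxx //; lia.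
    have [le_k|lt_k] := leqP (a + b + c) k.
      have -> : a + b + c - k.+1 = 0 by lia.
      exact: connect0.
    apply: connect_trans (IHk (a + b + c - k) _ erefl) _; first by lia.
    by apply: arc_inord; rewrite /shape_arc /shape_step; do ?case: ifP; lia.
  rewrite -(gK u) -(gK v) -(inord_val (g u)) -(inord_val (g v)).
  exact: connect_trans (to0 _ (leq_ord _)) (from0 _ (leq_ord _)).
case: shape_D => h bij_h arcE; have inj_h := bij_inj bij_h.
have [g hK gK] := bij_h.
have out_h i : [set v | arc (h i) v]%SET = h @: [set j : 'I__ | shape_arc a b c i j]%SET.
  apply/setP => v; rewrite -(gK v) mem_imset // !inE arcE //.
rewrite digraph_sizeE (reindex h) /=; last by exists g => v _.
rewrite big_ord_recl out_h card_imset //.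
have -> : [set j : 'I_(a + b + c).+1 | shape_arc a b c 0 j]%SET
          = [set inord (a + c); inord (a + b + c)]%SET.
  apply/setP => j; rewrite !inE /shape_arc /= -!val_eqE /= !inordK //; lia.
rewrite cards2 -val_eqE /= !inordK; try lia.
rewrite (eq_bigr (fun=> 1)) => [|i _].
  by rewrite sum1_card card_ord; lia.
rewrite out_h card_imset // -(cards1 (inord (shape_step a c i.+1) : 'I_(a + b + c).+1)).
congr #|pred_of_set _|; apply/setP => j; rewrite !inE /shape_arc /= -val_eqE /= inordK //.
by rewrite /shape_step; case: ifP; have := ltn_ord i; lia.
Qed.

(** * Shapes of the two named families *)

Lemma walks_has_shape (m : nat) (ps : seq (seq nat)) (a b c : nat) (h : nat -> nat) :
  m = (a + b + c).+1 ->
  (forall i, i < m -> h i < m) ->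
  (forall i j, i < m -> j < m -> h i = h j -> i = j) ->
  (forall i j, i < m -> j < m ->
     (h i != h j) && has (fun p => (h i, h j) \in walk_arcs p) ps = shape_arc a b c i j) ->
  has_shape (walks_digraph m ps) a b c.
Proof.
move=> ->{m} h_lt h_inj h_arc.
exists (fun i => inord (h i)) => [|i j].
  apply: injF_bij => i j /(congr1 val); rewrite /= !inordK ?h_lt // => /h_inj ij.
  by apply/val_inj/ij.
by rewrite -h_arc // /Defs.arc /= /walks_arc -val_eqE /= !inordK ?h_lt.
Qed.

Lemma walk_arcs_iota (x m b y u v : nat) :
  ((u, v) \in walk_arcs (x :: rcons (iota m b.+1) y)) =
  [|| (u == x) && (v == m), (m <= u < m + b) && (v == u.+1) | (u == m + b) && (v == y)].
Proof.
elim: b x m => [|b IHb] x m.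
  by rewrite /walk_arcs /= !inE !xpair_eqE; lia.
have -> : walk_arcs (x :: rcons (iota m b.+2) y)
          = (x, m) :: walk_arcs (m :: rcons (iota m.+1 b.+1) y) by [].
by rewrite inE IHb xpair_eqE; lia.
Qed.

(** Shape labels decrease along the cycles while the walks of [infty] increase, so the labelling
    fixes 0 and reverses the rest of each cycle. *)
Lemma infty_shape (a b : nat) : has_shape (infty a.+2 b.+2) a.+1 b.+1 0.
Proof.
apply: (@walks_has_shape _ _ _ _ _ (fun i =>
  if i == 0 then 0 else if i < a.+2 then a.+2 - i else a.+2 + a.+2 + b - i)).
- by lia.
- by move=> i lt_i; do 2?[case: ifP => ?]; lia.
- by move=> i j lt_i lt_j; do 4?[case: ifP => ?]; lia.
move=> i j; rewrite [_ - 1]subn1 => lt_i lt_j; rewrite !subn1 [_.-1]/= [b.+2.-1]/= /= !walk_arcs_iota /shape_arc /shape_step.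
have [i0|i_neq0] := eqVneq i 0; first by do 2?[case: ifP => ?]; lia.
have [s -> s_spec] : exists2 s, (if i == (a.+1 + 0).+1 then 0 else i.-1) = s &
    (i = a.+2 /\ s = 0 \/ i <> a.+2 /\ s.+1 = i).
  by case: eqP => ?; [exists 0|exists i.-1]; lia.
(* [lia] is slow on the truncated differences of the goal. *)
have sub_witness k l : l <= k -> exists2 u, k - l = u & u + l = k.
  by move=> le_lk; exists (k - l); rewrite ?subnK.
do 4?[case: ifP => ?]; try by (exfalso; lia).
all: repeat match goal with |- context [?k - ?l] =>
  let u := fresh "u" in let E := fresh in have [|u -> E] := sub_witness k l; first by lia end.
all: clear sub_witness; rewrite /= in lt_i lt_j.
all: by apply/idP/idP => [/andP[_ /or3P[/or3P[]|/or3P[]|//] /andP[]]|/eqP js]; lia.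
Qed.

(** [theta] branches at 1 but shapes branch at 0, hence the exchange of 0 and 1; the long branch is
    reversed. *)
Lemma theta_shape (b : nat) : has_shape (theta 0 b.+1 0) 0 b.+1 1.
Proof.
apply: (@walks_has_shape _ _ _ _ _ (fun i => if i < 2 then 1 - i else b + 4 - i)).
- by lia.
- by move=> i lt_i; case: ifP => ?; lia.
- by move=> i j lt_i lt_j; do 2?[case: ifP => ?]; lia.
move=> i j lt_i lt_j; rewrite /= !walk_arcs_iota /walk_arcs /= !inE !xpair_eqE.
by rewrite /shape_arc /shape_step; do 4?[case: ifP => ?]; lia.
Qed.

(** * Spectral radius from a positive eigenvector *)

Section Spectral.

Local Open Scope ring_scope.
Variable R : realType.

Local Notation normc := (@Normc.normc R).

Lemma normc_sum (I : finType) (F : I -> R[i]) :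
  normc (\sum_i F i) <= \sum_i normc (F i).
Proof.
elim/big_ind2: _ => [|z u z' u' le_z le_z'|//].
  by rewrite Normc.normc0.
exact: le_trans (le_normcD _ _) (lerD le_z le_z').
Qed.

Lemma normc_ge0 (z : R[i]) : 0 <= normc z.
Proof. by case: z => a b; exact: sqrtr_ge0. Qed.

(** If a row [v] is an eigenvector for [z], weighting its moduli by [w] and using the triangle
    inequality gives [normc z * S <= r * S] with [S > 0]. Conversely the column [w] is killed by
    [M - r], which is therefore singular, so [r] is an eigenvalue. *)
Lemma spectral_radius_positive_eigenvector (D : digraph) (w : vertex D -> R) (r : R) :
  (0 < digraph_order D)%N -> (forall u, 0 < w u) ->
  (forall u, \sum_(v | arc u v) w v = r * w u) ->
  spectral_radius R D = r.
Proof.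
move=> D_gt0 w_gt0 wE; have /card_gt0P[x _] := D_gt0.
have r_ge0 : 0 <= r.
  rewrite -(pmulr_lge0 _ (w_gt0 x)) -wE; apply: sumr_ge0 => v _; exact: ltW.
set M := adjacency R[i] D.
have wM i : \sum_j normc (M i j) * w (enum_val j) = r * w (enum_val i).
  pose e : 'I_(digraph_order D) -> vertex D := enum_val.
  rewrite -wE [RHS](reindex e) /=; last first.
    by exists enum_rank => v _; rewrite /e ?enum_valK ?enum_rankK.
  rewrite [RHS]big_mkcond; apply: eq_bigr => j _; rewrite mxE.
  by case: (arc _ _); rewrite ?Normc.normc1 ?Normc.normc0 ?mul1r ?mul0r.
have r_ub : ubound [set normc z | z in [set z : R[i] | eigenvalue M z]]%classic r.
  move=> _ [z /eigenvalueP[v vM v_neq0] <-].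
  pose S := \sum_j normc (v 0 j) * w (enum_val j).
  have S_gt0 : 0 < S.
    have [j vj_neq0] := rV0Pn _ v_neq0.
    rewrite /S (bigD1 j) //= ltr_wpDr //.
      by apply: sumr_ge0 => k _; rewrite mulr_ge0 ?normc_ge0 // ltW.
    rewrite mulr_gt0 // lt_def normc_ge0 andbT.
    by apply: contra vj_neq0 => /eqP/Normc.eq0_normc ->.
  rewrite -(ler_pM2r S_gt0) /S !mulr_sumr.
  apply: (@le_trans _ _ (\sum_j \sum_i normc (v 0 i) * normc (M i j) * w (enum_val j))).
    apply: ler_sum => j _; rewrite mulrA -Normc.normcM.
    have /rowP/(_ j) := vM; rewrite !mxE => <-; rewrite -mulr_suml.
    apply: ler_wpM2r; first exact: ltW.
    apply: le_trans (normc_sum _) _; apply: ler_sum => i _.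
    by rewrite Normc.normcM.
  rewrite exchange_big /=; apply: ler_sum => i _.
  under eq_bigr do rewrite -mulrA.
  by rewrite -mulr_sumr wM mulrCA.
have r_in : [set normc z | z in [set z : R[i] | eigenvalue M z]]%classic r.
  exists (r%:C)%C; last by rewrite /= expr0n addr0 sqrtr_sqr ger0_norm.
  rewrite /= /eigenvalue /eigenspace kermx_eq0 row_free_unit; apply/negP => unitM.
  pose wc : 'cV[R[i]]_(digraph_order D) := \col_i (w (enum_val i))%:C%C.
  have : (M - (r%:C)%C%:M) *m wc = 0.
    rewrite mulmxBl mul_scalar_mx; apply/eqP; rewrite subr_eq0; apply/eqP/colP => i.
    rewrite !mxE -rmorphM -wM rmorph_sum /=; apply: eq_bigr => j _.
    rewrite !mxE; case: (arc _ _).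
      by rewrite Normc.normc1 !mul1r.
    by rewrite Normc.normc0 !mul0r.
  move/(congr1 (mulmx (invmx (M - (r%:C)%C%:M)))); rewrite mulKmx // mulmx0.
  move/colP/(_ (enum_rank x)); rewrite !mxE enum_rankK => -[w0].
  by have := w_gt0 x; rewrite w0 ltxx.
apply/eqP; rewrite eq_le ge_sup //; last by exists r.
by rewrite ub_le_sup //; exists r.
Qed.

Lemma shape_spectral_radius (D : digraph) (a b c : nat) :
  (0 < b)%N -> has_shape D a b c ->
  exists q : R, [/\ 0 < q < 1, q ^+ (a + c).+1 + q ^+ (b + c).+1 = 1 &
    spectral_radius R D = q^-1].
Proof.
move=> b_gt0 shape_D; have order_D := has_shape_order shape_D.
pose P : {poly R} := 'X ^+ (a + c).+1 + 'X ^+ (b + c).+1 - 1.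
have PE x : P.[x] = x ^+ (a + c).+1 + x ^+ (b + c).+1 - 1 by rewrite !hornerE.
have [q] : {q | q \in `]0, 1[ & root P q}.
  apply: polyrcf.poly_ivtoo; first exact: ler01.
  by rewrite !PE !expr0n !expr1n /= !add0r mulN1r oppr_lt0 addrK ltr01.
rewrite in_itv /= => q01 /rootP; rewrite PE => /eqP; rewrite subr_eq0 => /eqP qE.
exists q; split=> //; have /andP[q_gt0 _] := q01.
have q_neq0 : q != 0 by rewrite gt_eqF.
case: shape_D => h [g hK gK] arcE.
(* The distance from label [i] to 0; labels of the second branch exceed it by [a]. *)
pose d i := (if i <= a + c then i else i - a)%N.
apply: (spectral_radius_positive_eigenvector (w := fun v => q ^+ d (g v))).
- by rewrite order_D.
- by move=> v; rewrite exprn_gt0.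
move=> u; rewrite -(gK u) (reindex h) /=; last by exists g => v _.
under eq_bigl do rewrite arcE.
under eq_bigr do rewrite hK.
move: (g u) => i; rewrite hK; have := ltn_ord i; rewrite ltnS => lei.
(* Multiplied by [q], the eigenvector equation at 0 is the equation [qE]; elsewhere it says that a
   step lowers the distance by one. *)
apply: (mulfI q_neq0); rewrite mulVKf //.
have [i0|i_neq0] := eqVneq (i : nat) 0%N.
  rewrite (bigD1 (inord (a + c))) /=; last by rewrite /shape_arc i0 inordK ?eqxx //; lia.
  rewrite (bigD1 (inord (a + b + c))) /=; last first.
    by rewrite /shape_arc i0 -val_eqE /= !inordK ?eqxx ?orbT //; lia.
  rewrite big_pred0 ?addr0; last first.
    by move=> j; rewrite /shape_arc i0 -!val_eqE /= !inordK; lia.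
  rewrite !inordK; try lia.
  rewrite i0 /d leqnn leq0n ifN; last by lia.
  by rewrite mulrDr -!exprS (_ : (a + b + c - a)%N = (b + c)%N) //; lia.
have step_le : (shape_step a c i <= a + b + c)%N by rewrite /shape_step; case: ifP; lia.
rewrite (big_pred1 (inord (shape_step a c i))) => [|j]; last first.
  by rewrite /shape_arc (negPf i_neq0) /= -val_eqE /= inordK.
rewrite inordK // -exprS /d /shape_step; congr (_ ^+ _).
by case: (i =P (a + c).+1 :> nat) => ?; do 2?[case: ifP => ?]; lia.
Qed.

End Spectral.

(** * Inequalities between cycle sums *)

Section Comparison.

Local Open Scope ring_scope.
Variable R : realType.
Implicit Types q : R.

(** For a shape of order [n] the exponents are the lengths of its two directed cycles, each missing
    one branch. *)
Definition cycle_sum (n a b : nat) q : R := q ^+ (n - a) + q ^+ (n - b).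

(** Cycle sums increase with [q]: if the second sum exceeds 1 at the root of the first, its own root
    is smaller and the reciprocal larger. *)
Lemma shape_radius_lt (n : nat) (D D' : digraph) (a b c a' b' c' : nat) :
  (0 < b)%N -> (a + b + c).+1 = n -> has_shape D a b c ->
  (0 < b')%N -> (a' + b' + c').+1 = n -> has_shape D' a' b' c' ->
  (forall q, 0 < q < 1 -> cycle_sum n a b q = 1 -> 1 < cycle_sum n a' b' q) ->
  spectral_radius R D < spectral_radius R D'.
Proof.
move=> b_gt0 nE shape_D b'_gt0 nE' shape_D' dominates.
have [q [q01 qE ->]] := shape_spectral_radius R b_gt0 shape_D.
have [q' [q'01 qE' ->]] := shape_spectral_radius R b'_gt0 shape_D'.
have [q_gt0 q'_gt0] : 0 < q /\ 0 < q' by case/andP: q01; case/andP: q'01.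
have [nb na] : (n - b = (a + c).+1 /\ n - a = (b + c).+1)%N by split; lia.
have [nb' na'] : (n - b' = (a' + c').+1 /\ n - a' = (b' + c').+1)%N by split; lia.
rewrite ltf_pV2 ?posrE // ltNge; apply/negP => le_q.
have := dominates q q01; rewrite /cycle_sum na nb na' nb' addrC qE => /(_ erefl).
apply/negP; rewrite -leNgt -qE' addrC.
by apply: lerD; apply: lerXn2r; rewrite ?nnegrE ?(ltW q_gt0) ?(ltW q'_gt0).
Qed.

Lemma shape_radius_eq (D D' : digraph) (a b c : nat) :
  (0 < b)%N -> has_shape D a b c -> has_shape D' a b c ->
  spectral_radius R D = spectral_radius R D'.
Proof.
move=> b_gt0 /(shape_spectral_radius R b_gt0)[q [/andP[q_gt0 _] qE ->]].
move=> /(shape_spectral_radius R b_gt0)[q' [/andP[q'_gt0 _] q'E ->]].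
congr _^-1; have lt_absurd x y : 0 < x -> x < y ->
    x ^+ (a + c).+1 + x ^+ (b + c).+1 = 1 -> y ^+ (a + c).+1 + y ^+ (b + c).+1 = 1 -> False.
  move=> x_gt0 lt_xy <- /eqP; rewrite gt_eqF // ltrD // ltrXn2r //; exact: ltW.
by case: (ltgtP q q') => [lt_q|lt_q|//]; case: (lt_absurd _ _ _ _ lt_q).
Qed.

(** Strict convexity in the exponent: the difference factors as
    [(q ^+ i - q ^+ k) * (1 - q ^+ (j - i))]. *)
Lemma exprn_spread (q : R) (i j k l : nat) : 0 < q < 1 ->
  (i < j)%N -> (j <= k)%N -> (i + l = j + k)%N -> q ^+ j + q ^+ k < q ^+ i + q ^+ l.
Proof.
move=> /andP[q_gt0 q_lt1] lt_ij le_jk sumE.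
have -> : j = (i + (j - i))%N by lia.
have -> : l = (k + (j - i))%N by lia.
rewrite !exprD; set r := q ^+ (j - i).
have r_lt1 : r < 1 by rewrite exprn_ilt1 ?ltW // subn_eq0 -ltnNge.
have lt_ki : q ^+ k < q ^+ i by rewrite ltr_iXn2l //; lia.
rewrite -subr_gt0 (_ : _ - _ = (q ^+ i - q ^+ k) * (1 - r)); last by ring.
by rewrite mulr_gt0 ?subr_gt0.
Qed.

(** For [a <= m] each exponent is compared directly. For [a > m], first raise [b] to [n - a - 1],
    then spread the exponents. The case [m = 1] serves the maximum, [m = 2] the pairs with
    [b < n - 2]. *)
Lemma cycle_sum_lt (n m a b : nat) (q : R) : 0 < q < 1 ->
  (a <= b)%N -> (a + b < n)%N -> (m + b < n)%N -> (2 * m < n)%N ->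
  (a, b) != (m, (n - m).-1) -> cycle_sum n a b q < cycle_sum n m (n - m).-1 q.
Proof.
move=> q01 le_ab lt_abn lt_mbn lt_mn; rewrite xpair_eqE => neq_ab.
have /andP[q_gt0 q_lt1] := q01; rewrite /cycle_sum.
have [le_am|lt_ma] := leqP a m.
  have [eq_am|neq_am] := eqVneq a m.
    rewrite eq_am eqxx /= in neq_ab *; rewrite ltrD2l ltr_iXn2l //.
    by move/eqP: neq_ab; lia.
  apply: ltr_leD; first by rewrite ltr_iXn2l //; lia.
  by rewrite ler_iXn2l //; lia.
apply: (@le_lt_trans _ _ (q ^+ (a.+1) + q ^+ (n - a))).
  by rewrite addrC lerD2r ler_iXn2l //; lia.
rewrite [ltRHS]addrC (_ : n - (n - m).-1 = m.+1)%N; last by lia.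
by apply: exprn_spread => //; lia.
Qed.

Lemma theta_over_infty (n : nat) (q : R) : 0 < q < 1 -> (8 <= n)%N ->
  1 <= q ^+ 3 + q ^+ (n - 2) -> 1 < q ^+ 2 + q ^+ n.
Proof.
move=> q01 n_ge8 qE; have /andP[q_gt0 q_lt1] := q01.
have qE6 : 1 <= q ^+ 3 + q ^+ 6.
  by apply: le_trans qE _; rewrite lerD2l ler_iXn2l //; lia.
(* 85/100 lies between the root of [X^4 + X^3 + X^2 - X - 1], about 0.848, and that
   of [X^6 + X^3 - 1], about 0.852. *)
have q_ge : 85 / 100 <= q.
  rewrite leNgt; apply/negP => lt_q.
  have q3 : q ^+ 3 < (85 / 100) ^+ 3 by rewrite ltrXn2r //; lra.
  have q6 : q ^+ 6 < (85 / 100) ^+ 6 by rewrite ltrXn2r //; lra.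
  by lra.
have -> : n = (n - 2 + 2)%N by lia.
rewrite exprD; set r := q ^+ (n - 2) in qE *.
(* Bounding [r] below by [1 - q ^+ 3] removes [n]; what remains, [2 q^2 - q^5 - 1], has the factor
   [1 - q]. *)
have le_r : q ^+ 2 + (1 - q ^+ 3) * q ^+ 2 <= q ^+ 2 + r * q ^+ 2.
  by rewrite lerD2l ler_wpM2r ?exprn_ge0 //; lra.
apply: lt_le_trans le_r.
rewrite -subr_gt0 (_ : _ - 1 = (1 - q) * (q ^+ 4 + q ^+ 3 + q ^+ 2 - q - 1)); last by ring.
rewrite mulr_gt0 ?subr_gt0 //.
(* Replacing each power by 85/100 times the preceding one leaves an inequality linear in [q]. *)
have q2 : (85 / 100) * q <= q ^+ 2 by rewrite expr2 ler_wpM2r ?(ltW q_gt0).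
have q3 : (85 / 100) * q ^+ 2 <= q ^+ 3 by rewrite [leRHS]exprS ler_wpM2r ?exprn_ge0 ?(ltW q_gt0).
have q4 : (85 / 100) * q ^+ 3 <= q ^+ 4 by rewrite [leRHS]exprS ler_wpM2r ?exprn_ge0 ?(ltW q_gt0).
by lra.
Qed.

(** The two sums differ by [(q^2 - q^3) (q^(n-4) + q^(n-3) - 1)]. For [n = 5] and [n = 6] the last
    factor is positive by termwise comparison with [q^2 + q^n = 1]; [n = 7] needs a numerical bound
    on [q]. *)
Lemma infty_over_theta (n : nat) (q : R) : 0 < q < 1 -> (5 <= n <= 7)%N ->
  q ^+ 2 + q ^+ n = 1 -> 1 < q ^+ 3 + q ^+ (n - 2).
Proof.
move=> q01 n57 qE; have /andP[q_gt0 q_lt1] := q01.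
have pow_lt i j : (j < i)%N -> q ^+ i < q ^+ j by move=> ?; rewrite ltr_iXn2l.
have : [|| n == 5, n == 6 | n == 7]%N by lia.
case/or3P => /eqP nE; rewrite nE /= in qE *.
- suff : 0 < (q ^+ 2 - q ^+ 3) * (q ^+ 2 + q - 1).
    suff -> : (q ^+ 2 - q ^+ 3) * (q ^+ 2 + q - 1)
      = q ^+ 3 + q ^+ 3 - (q ^+ 2 + q ^+ 5) by rewrite qE subr_gt0.
    by ring.
  have := pow_lt 5 1 isT; rewrite expr1 => ?.
  by rewrite mulr_gt0 ?subr_gt0 ?pow_lt //; lra.
- suff : 0 < (q ^+ 2 - q ^+ 3) * (q ^+ 2 + q ^+ 3 - 1).
    suff -> : (q ^+ 2 - q ^+ 3) * (q ^+ 2 + q ^+ 3 - 1)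
      = q ^+ 3 + q ^+ 4 - (q ^+ 2 + q ^+ 6) by rewrite qE subr_gt0.
    by ring.
  by rewrite mulr_gt0 ?subr_gt0 ?pow_lt //; have := pow_lt 6 3 isT; lra.
(* 83/100 lies between the root of [X^4 + X^3 - 1], about 0.819, and that of [X^7 + X^2 - 1], about
   0.840. *)
- have q_ge : 83 / 100 <= q.
    rewrite leNgt; apply/negP => lt_q.
    have q2 : q ^+ 2 < (83 / 100) ^+ 2 by rewrite ltrXn2r //; lra.
    have q7 : q ^+ 7 < (83 / 100) ^+ 7 by rewrite ltrXn2r //; lra.
    by lra.
  have q3 : (83 / 100) ^+ 3 <= q ^+ 3 by rewrite lerXn2r ?nnegrE //; lra.
  have q4 : (83 / 100) ^+ 4 <= q ^+ 4 by rewrite lerXn2r ?nnegrE //; lra.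
  suff : 0 < (q ^+ 2 - q ^+ 3) * (q ^+ 3 + q ^+ 4 - 1).
    suff -> : (q ^+ 2 - q ^+ 3) * (q ^+ 3 + q ^+ 4 - 1)
      = q ^+ 3 + q ^+ 5 - (q ^+ 2 + q ^+ 7) by rewrite qE subr_gt0.
    by ring.
  by rewrite mulr_gt0 ?subr_gt0 ?pow_lt //; lra.
Qed.

End Comparison.

(* The shape of the claimed second maximum, infty(3,n-2) or theta(0,n-2,0). *)
Definition second_a (n : nat) : nat := if 5 <= n <= 7 then 2 else 0.
Definition second_b (n : nat) : nat := if 5 <= n <= 7 then n - 3 else n - 2.
Definition second_c (n : nat) : nat := if 5 <= n <= 7 then 0 else 1.

(** * The maximum, the second maximum and its uniqueness *)

Section SecondMaximum.

Variables (R : realType) (n : nat).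
Hypothesis n_ge4 : 4 <= n.

Local Notation rho := (spectral_radius R).
Local Notation a0 := (second_a n).
Local Notation b0 := (second_b n).
Local Notation c0 := (second_c n).

(** For [n >= 5] the pair [(2, n - 3)] has the largest sum among those with [b < n - 2]. It is the
    claimed second for [n <= 7]; from 8 on, [theta_over_infty] passes from it to [(0, n - 2)]. *)
Lemma second_cycle_sum_gt1 (a b : nat) (q : R) :
  (0 < q < 1)%R -> a <= b -> a + b < n -> b < n - 2 -> (a, b) != (a0, b0) ->
  cycle_sum n a b q = 1%R -> (1 < cycle_sum n a0 b0 q)%R.
Proof.
move=> q01 le_ab lt_ab lt_b; have /andP[q_gt0 q_lt1] := q01.
(* For [n = 4] the pair [(2, n - 3)] violates [a <= b]; here [a] and [b] are at most 1, so both
   exponents are at least 3. *)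
have [n_eq4|n_ge5] : n = 4 \/ 5 <= n by lia.
  rewrite /second_a /second_b n_eq4 /= => _ <-; rewrite /cycle_sum.
  apply: (@le_lt_trans _ _ (q ^+ 3 + q ^+ 3)%R); last first.
    by rewrite [ltRHS]addrC; apply: exprn_spread.
  by apply: lerD; rewrite ler_iXn2l //; lia.
have bE : n - 3 = (n - 2).-1 by lia.
rewrite /second_a /second_b; case: ifP => [n57 neq_ab <-|n57 _ qE].
  by rewrite bE; apply: cycle_sum_lt => //; rewrite -?bE //; lia.
rewrite /cycle_sum subn0 addrC (_ : n - (n - 2) = 2); last by lia.
apply: theta_over_infty => //; first by lia.
rewrite -qE addrC.
have [[-> ->]|neq_ab] := eqVneq (a, b) (2, n - 3).
  by rewrite /cycle_sum (_ : n - (n - 3) = 3) //; lia.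
rewrite bE in neq_ab; have := @cycle_sum_lt R n 2 a b q q01 le_ab lt_ab _ _ neq_ab.
rewrite {2}/cycle_sum -bE (_ : n - (n - 3) = 3); last by lia.
by move=> lt_sum; apply/ltW/lt_sum; lia.
Qed.

Lemma max_dichotomy (D Dmax : digraph) :
  bicyclic n D -> has_shape Dmax 1 (n - 2) 0 ->
  has_shape D 1 (n - 2) 0 \/ (rho D < rho Dmax)%R.
Proof.
move=> bic_D shape_max; have n_gt1 : 1 < n by lia.
have [a [b [c [le_ab b_gt0 ac_gt0 nE shape_D]]]] := bicyclic_shape n_gt1 bic_D.
have [abE|neq_ab] := eqVneq (a, b) (1, n - 2).
  case: abE shape_D nE => -> -> shape_D nE; left.
  by have c_eq0 : c = 0 by [lia]; rewrite c_eq0 in shape_D.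
right; have bE : n - 2 = (n - 1).-1 by lia.
apply: (shape_radius_lt b_gt0 nE shape_D _ _ shape_max); try lia.
by move=> q q01 <-; rewrite bE in neq_ab *; apply: cycle_sum_lt => //; lia.
Qed.

Lemma second_trichotomy (D D0 : digraph) :
  bicyclic n D -> has_shape D0 a0 b0 c0 ->
  [\/ has_shape D 1 (n - 2) 0, has_shape D a0 b0 c0 | (rho D < rho D0)%R].
Proof.
move=> bic_D shape_0; have n_gt1 : 1 < n by lia.
have [a [b [c [le_ab b_gt0 ac_gt0 nE shape_D]]]] := bicyclic_shape n_gt1 bic_D.
have [b0_gt0 nE0] : 0 < b0 /\ (a0 + b0 + c0).+1 = n.
  by rewrite /second_a /second_b /second_c; case: ifP; lia.
have [abE|neq_ab] := eqVneq (a, b) (a0, b0).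
  case: abE shape_D nE => -> -> shape_D nE; apply: Or32.
  by have cE : c = c0 by [lia]; rewrite cE in shape_D.
have [lt_b|le_b] := ltnP b (n - 2).
  apply: Or33; apply: (shape_radius_lt b_gt0 nE shape_D b0_gt0 nE0 shape_0) => q q01 qE.
  by apply: second_cycle_sum_gt1 qE => //; lia.
(* Now [a + c = 1], so only [(0, n - 2)] and the maximum [(1, n - 2)] remain. *)
have bE : b = n - 2 by lia.
have [a1|a_neq1] := eqVneq a 1.
  by apply: Or31; rewrite a1 bE (_ : c = 0) in shape_D; last lia.
have aE : a = 0 by lia.
(* For other [n] the pair [(0, n - 2)] is the claimed second itself. *)
have smallT : 5 <= n <= 7.
  by apply: contraNT neq_ab => /negPf sF; rewrite aE bE /second_a /second_b sF.
apply: Or33; apply: (shape_radius_lt b_gt0 nE shape_D b0_gt0 nE0 shape_0) => q q01.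
rewrite aE bE /second_a /second_b smallT /cycle_sum subn0 !subKn; try lia.
by rewrite addrC => qE; rewrite addrC; apply: infty_over_theta.
Qed.

Lemma second_lt_max (D0 Dmax : digraph) :
  has_shape D0 a0 b0 c0 -> has_shape Dmax 1 (n - 2) 0 -> (rho D0 < rho Dmax)%R.
Proof.
move=> shape_0 shape_max; have bE : n - 2 = (n - 1).-1 by lia.
apply: (@shape_radius_lt R n _ _ _ _ _ _ _ _ _ _ shape_0 _ _ shape_max); try lia.
- by rewrite /second_b; case: ifP; lia.
- by rewrite /second_a /second_b /second_c; case: ifP; lia.
move=> q q01 <-; rewrite bE; apply: cycle_sum_lt => //; try lia.
all: by rewrite ?xpair_eqE /second_a /second_b; case: ifP => ? //; lia.
Qed.

Lemma second_max_shape (D0 Dmax : digraph) :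
  bicyclic n D0 -> has_shape D0 a0 b0 c0 ->
  bicyclic n Dmax -> has_shape Dmax 1 (n - 2) 0 ->
  achieves_second_max (bicyclic n) rho D0 /\
  (forall D, achieves_second_max (bicyclic n) rho D -> digraph_iso D D0).
Proof.
move=> bic_0 shape_0 bic_max shape_max.
have n2_gt0 : 0 < n - 2 by lia.
have b0_gt0 : 0 < b0 by rewrite /second_b; case: ifP; lia.
have lt_0max := second_lt_max shape_0 shape_max.
have le_max D : bicyclic n D -> (rho D <= rho Dmax)%R.
  move=> bic_D; have [shape_D|/ltW //] := max_dichotomy bic_D shape_max.
  by rewrite (shape_radius_eq R n2_gt0 shape_D shape_max).
split.
  exists Dmax => //; split=> // D [bic_D lt_Dmax].
  have [shape_D|shape_D|/ltW //] := second_trichotomy bic_D shape_0.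
    by rewrite (shape_radius_eq R n2_gt0 shape_D shape_max) ltxx in lt_Dmax.
  by rewrite (shape_radius_eq R b0_gt0 shape_D shape_0).
move=> D [M [bic_M max_M] [[bic_D lt_DM] max_D]].
have M_max : rho M = rho Dmax by apply/eqP; rewrite eq_le le_max ?max_M.
rewrite {}M_max in lt_DM max_D.
have [shape_D|shape_D|] := second_trichotomy bic_D shape_0.
- by rewrite (shape_radius_eq R n2_gt0 shape_D shape_max) ltxx in lt_DM.
- exact: shape_iso shape_D shape_0.
- by rewrite ltNge max_D.
Qed.

End SecondMaximum.

Theorem theorem4 (R : realType) (n : nat) (hn : 4 <= n) :
  let D0 := if 5 <= n <= 7 then infty 3 (n - 2) else theta 0 (n - 2) 0 in
  achieves_second_max (bicyclic n) (spectral_radius R) D0 /\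
  (forall D : digraph,
     achieves_second_max (bicyclic n) (spectral_radius R) D ->
     digraph_iso D D0).
Proof.
move=> D0.
(* The maximum is attained by [infty 2 (n - 1)]. *)
have shape_max : has_shape (infty 2 (n - 1)) 1 (n - 2) 0.
  by have := infty_shape 0 (n - 3); congr (has_shape (infty _ _) _ _ _); lia.
have shape_0 : has_shape D0 (second_a n) (second_b n) (second_c n).
  rewrite /D0 /second_a /second_b /second_c; case: ifP => [n57|_].
    have := infty_shape 1 (n - 4); congr (has_shape (infty _ _) _ _ _); lia.
  by have := theta_shape (n - 3); congr (has_shape (theta _ _ _) _ _ _); lia.
apply: (second_max_shape R hn _ shape_0 _ shape_max).
  have := shape_bicyclic _ shape_0; rewrite (_ : (_ + _ + _).+1 = n).
    by apply; rewrite /second_b; case: ifP; lia.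
  by rewrite /second_a /second_b /second_c; case: ifP; lia.
have := shape_bicyclic _ shape_max; rewrite (_ : (1 + (n - 2) + 0).+1 = n); last by lia.
by apply; lia.
Qed.
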